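(* Let $R$ and $S$ be finite-dimensional quantum systems with Hamiltonians $H_R$ and $H_S$, and let $H_{RS}=H_R\otimes\mathbf{1}_S+\mathbf{1}_R\otimes H_S$. Let $\rho_R$ be any state on $R$, let $\rho_S$ be a state on $S$ with $[\rho_S,H_S]=0$, and let $\mathcal{E}$ be a time-translation covariant channel on $RS$. If $\mathcal{E}(\rho_R\otimes\rho_S)=\rho_R|\rho'_S$, i.e. ${\rm Tr}_S\,\mathcal{E}(\rho_R\otimes\rho_S)=\rho_R$ and $\rho'_S:={\rm Tr}_R\,\mathcal{E}(\rho_R\otimes\rho_S)$, then $[\rho'_S,H_S]=0$. In particular, quantum coherence can neither be broadcast nor cloned: there are no $\rho_R$, $\rho_S$ with $[\rho_S,H_S]=0$ and time-translation covariant $\mathcal{E}$ with $\mathcal{E}(\rho_R\otimes\rho_S)=\rho_R|\rho'_S$ and $[\rho'_S,H_S]\neq0$ (and a fortiori none with $\mathcal{E}(\rho_R\otimes\rho_S)=\rho_R\otimes\rho'_S$ and $[\rho'_S,H_S]\neq 0$).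
   Context: A channel is a completely positive trace-preserving map. For a system $X$ with Hamiltonian $H_X$, write $\mathcal{U}^X_t(\sigma)=e^{-itH_X}\sigma e^{itH_X}$ for $t\in\mathbb{R}$. A channel $\mathcal{E}$ on $RS$ is time-translation covariant if $\mathcal{E}\circ(\mathcal{U}^R_t\otimes\mathcal{U}^S_t)=(\mathcal{U}^R_t\otimes\mathcal{U}^S_t)\circ\mathcal{E}$ for all $t\in\mathbb{R}$. The notation $\rho_R|\rho'_S$ denotes some (possibly correlated) bipartite state on $RS$ whose reduced states are $\rho_R$ on $R$ and $\rho'_S$ on $S$. *)

(* Defs.v *)
From Stdlib Require Import Reals Arith Factorial.
Open Scope R_scope.

Definition C : Type := (R * R)%type.
Definition C0 : C := (0, 0).
Definition C1 : C := (1, 0).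
Definition Cadd (x y : C) : C := (fst x + fst y, snd x + snd y).
Definition Cmul (x y : C) : C :=
  (fst x * fst y - snd x * snd y, fst x * snd y + snd x * fst y).
Definition Cconj (x : C) : C := (fst x, - snd x).

Fixpoint Csum (n : nat) (f : nat -> C) : C :=
  match n with
  | O => C0
  | S m => Cadd (Csum m f) (f m)
  end.

(* Matrices: only the entries with indices < dimension are meaningful. *)
Definition Mat : Type := nat -> nat -> C.

Definition meq (n : nat) (A B : Mat) : Prop :=
  forall i j, (i < n)%nat -> (j < n)%nat -> A i j = B i j.

Definition madd (A B : Mat) : Mat := fun i j => Cadd (A i j) (B i j).
Definition mscale (c : C) (A : Mat) : Mat := fun i j => Cmul c (A i j).
Definition mmul (n : nat) (A B : Mat) : Mat :=
  fun i j => Csum n (fun k => Cmul (A i k) (B k j)).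
Definition madj (A : Mat) : Mat := fun i j => Cconj (A j i).
Definition mtrace (n : nat) (A : Mat) : C := Csum n (fun i => A i i).
Definition mid : Mat := fun i j => if Nat.eqb i j then C1 else C0.

Fixpoint mpow (n : nat) (A : Mat) (m : nat) : Mat :=
  match m with
  | O => mid
  | S k => mmul n (mpow n A k) A
  end.

(* Tensor product A (x) B, with B acting on a dS-dimensional factor;
   composite index k = i * dS + j. *)
Definition kron (dS : nat) (A B : Mat) : Mat :=
  fun k l => Cmul (A (k / dS)%nat (l / dS)%nat) (B (k mod dS)%nat (l mod dS)%nat).

Definition ptraceS (dR dS : nat) (X : Mat) : Mat :=
  fun i j => Csum dS (fun k => X (i * dS + k)%nat (j * dS + k)%nat).
Definition ptraceR (dR dS : nat) (X : Mat) : Mat :=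
  fun i j => Csum dR (fun k => X (k * dS + i)%nat (k * dS + j)%nat).

Definition hermitian (n : nat) (H : Mat) : Prop := meq n (madj H) H.

Definition psd (n : nat) (A : Mat) : Prop :=
  forall v : nat -> C,
    let q := Csum n (fun i => Csum n (fun j => Cmul (Cconj (v i)) (Cmul (A i j) (v j)))) in
    snd q = 0 /\ 0 <= fst q.

Definition density (n : nat) (rho : Mat) : Prop := psd n rho /\ mtrace n rho = C1.

Definition lin_map (n : nat) (E : Mat -> Mat) : Prop :=
  (forall A B, meq n A B -> meq n (E A) (E B)) /\
  (forall (a : C) A B, meq n (E (madd A (mscale a B))) (madd (E A) (mscale a (E B)))).

(* (id_k (x) E) applied to X on C^k (x) C^n: block (p/n, q/n) is mapped by E *)
Definition ampl (n : nat) (E : Mat -> Mat) (X : Mat) : Mat :=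
  fun p q => E (fun i j => X ((p / n) * n + i)%nat ((q / n) * n + j)%nat)
               (p mod n)%nat (q mod n)%nat.

Definition completely_positive (n : nat) (E : Mat -> Mat) : Prop :=
  forall (k : nat) (X : Mat), psd (k * n) X -> psd (k * n) (ampl n E X).

Definition trace_preserving (n : nat) (E : Mat -> Mat) : Prop :=
  forall A, mtrace n (E A) = mtrace n A.

Definition channel (n : nat) (E : Mat -> Mat) : Prop :=
  lin_map n E /\ completely_positive n E /\ trace_preserving n E.

Definition expsum (n : nat) (A : Mat) (N : nat) : Mat :=
  fun i j => Csum N (fun m => Cmul (/ INR (Factorial.fact m), 0) (mpow n A m i j)).

Definition is_expm (n : nat) (A V : Mat) : Prop :=
  forall i j, (i < n)%nat -> (j < n)%nat ->
    Un_cv (fun N => fst (expsum n A N i j)) (fst (V i j)) /\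
    Un_cv (fun N => snd (expsum n A N i j)) (snd (V i j)).

Definition Ad (n : nat) (U X : Mat) : Mat := mmul n (mmul n U X) (madj U).

(* E o (U^R_t (x) U^S_t) = (U^R_t (x) U^S_t) o E for all real t, where
   U^X_t = Ad(e^{-itH_X}); note (x)-product of Ad's is Ad of the kron. *)
Definition tt_covariant (dR dS : nat) (HR HS : Mat) (E : Mat -> Mat) : Prop :=
  forall (t : R) (V W : Mat),
    is_expm dR (mscale (0, - t) HR) V ->
    is_expm dS (mscale (0, - t) HS) W ->
    forall X : Mat,
      meq (dR * dS) (E (Ad (dR * dS) (kron dS V W) X))
                    (Ad (dR * dS) (kron dS V W) (E X)).

(* Main.v *)
(** Write [Lam X = E (X (x) rhoS)], with Kraus operators [L_a], and let [Lam^*] be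
    its dual.  Differentiating the covariance of [E] at [t = 0] shows that
    [Lam^*] intertwines the commutators with [HR (x) 1 + 1 (x) HS] and with
    [HR].  Averaging the fixed state [rhoR] over time gives a fixed state
    [sigma] that commutes with [HR] and whose support projection [P] contains
    the support of [rhoR].  Put [Psi A = P Lam^*(A (x) 1) P].

    If [Psi A = A], then [sum_a tr (sigma |(A (x) 1) L_a P - L_a P A|^2) = 0],
    so [A] is intertwined by every [L_a P].  Hence the fixed points of [Psi]
    are closed under adjoints, [P Lam^*(1 (x) B) P] lies in their commutant, and
    [Psi] maps this commutant, and its image under [[HR, .]], to itself.  If
    [tr (rhoR Lam^*(1 (x) [HS, B])) = tr (rhoR [HR, P Lam^*(1 (x) B) P])] were
    nonzero, the [Psi]-invariant functional [tr (rhoR .)] would be nonzero on that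
    image, so [Psi] would have a fixed point [Z = [HR, D] <> 0] with [D] in the
    commutant; but then [tr (Z Z^* ) = tr (HR [D, Z^*]) = 0], since [Z^*] is
    fixed too.  So [tr (rhoS' [HS, B]) = 0] for all [B]. *)

Require Import Defs.
From Stdlib Require Import Reals.
From Stdlib Require Import Lra Lia Factorial.
From HB Require structures.
From mathcomp Require all_boot all_order all_algebra.
From mathcomp Require sesquilinear spectral ring complex mxtens Rstruct.
Open Scope R_scope.

(** For [|t| <= 1] and [m >= 2] one has [|t|^m <= t^2], so every tail beyond the first two terms is
    at most [t^2] times the matching tail of the series of [exp c]. This yields both convergence and
    the quadratic remainder. *)
Lemma exp_dominated_series (a s : nat -> R) (c t : R) :
  0 <= c -> Rabs t <= 1 ->
  (forall m, Rabs (a m) <= (c * Rabs t) ^ m / INR (fact m)) ->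
  s O = 0 -> (forall m, s (S m) = s m + a m) ->
  {l : R | Un_cv s l /\ Rabs (l - (a O + a 1%nat)) <= exp c * t ^ 2}.
Proof.
intros c0 t1 Ha s0 sS.
destruct (exist_exp c) as [e He] eqn:Ee.
assert (expE : exp c = e) by (unfold exp; rewrite Ee; reflexivity).
pose (E := sum_f_R0 (fun i => / INR (fact i) * c ^ i)).
assert (Epos : forall i, 0 <= / INR (fact i) * c ^ i).
{ intros i; apply Rmult_le_pos; [left; apply Rinv_0_lt_compat, INR_fact_lt_0 | now apply pow_le]. }
assert (Ele : forall N, E N <= e).
{ intros N; apply sum_incr; [exact He | exact Epos]. }
assert (t2 : 0 <= t ^ 2) by nra.
assert (powle : forall m, (2 <= m)%nat -> Rabs t ^ m <= t ^ 2).
{ intros m Hm; replace m with (2 + (m - 2))%nat by lia.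
  rewrite pow_add, <- (pow2_abs t).
  assert (Rabs t ^ (m - 2) <= 1).
  { rewrite <- (pow1 (m - 2)); apply pow_incr; split; [apply Rabs_pos | exact t1]. }
  assert (0 <= Rabs t ^ 2) by (apply pow_le, Rabs_pos). nra. }
(* [s (S M)] contains the terms up to index [M], as [E M] does, whence the shift; [1 <= M] ensures
   that only terms of index at least 2 are compared. *)
assert (key : forall M k, (1 <= M)%nat ->
   Rabs (s (S (M + k)) - s (S M)) <= t ^ 2 * (E (M + k)%nat - E M)).
{ intros M k HM; induction k as [|k IH].
  - rewrite Nat.add_0_r, !Rminus_diag, Rabs_R0; lra.
  - rewrite Nat.add_succ_r, sS.
    replace (E (S (M + k))) with (E (M + k)%nat + / INR (fact (S (M + k))) * c ^ S (M + k))
      by reflexivity.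
    replace (s (S (M + k)) + a (S (M + k)) - s (S M))
      with ((s (S (M + k)) - s (S M)) + a (S (M + k))) by ring.
    eapply Rle_trans; [apply Rabs_triang |].
    assert (Rabs (a (S (M + k))) <= t ^ 2 * (/ INR (fact (S (M + k))) * c ^ S (M + k))).
    { eapply Rle_trans; [apply Ha |]; rewrite Rpow_mult_distr; unfold Rdiv.
      pose proof (powle (S (M + k)) ltac:(lia)) as Hp.
      pose proof (Epos (S (M + k))). nra. }
    lra. }
assert (Hcau : Cauchy_crit s).
{ intros eps Heps.
  destruct (CV_Cauchy E (exist _ e He) eps Heps) as [N HN].
  assert (HMk : forall M k, (S N <= M)%nat -> R_dist (s (S (M + k))) (s (S M)) < eps).
  { intros M k HM; unfold R_dist.
    eapply Rle_lt_trans; [apply key; lia |].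
    pose proof (HN (M + k)%nat M ltac:(lia) ltac:(lia)) as H1.
    unfold R_dist in H1; pose proof (Rle_abs (E (M + k)%nat - E M)).
    assert (t ^ 2 <= 1) by (rewrite <- (pow2_abs t); pose proof (Rabs_pos t); nra).
    assert (0 <= E (M + k)%nat - E M).
    { clear - Epos; induction k as [|k IH]; [rewrite Nat.add_0_r; lra |].
      rewrite Nat.add_succ_r.
      replace (E (S (M + k))) with (E (M + k)%nat + / INR (fact (S (M + k))) * c ^ S (M + k))
        by reflexivity.
      pose proof (Epos (S (M + k))); lra. }
    nra. }
  exists (S (S N)); intros n m Hn Hm.
  destruct n as [|n]; [lia |]; destruct m as [|m]; [lia |].
  destruct (Nat.le_ge_cases n m) as [H|H].
  - replace m with (n + (m - n))%nat by lia; rewrite R_dist_sym; apply HMk; lia.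
  - replace n with (m + (n - m))%nat by lia; apply HMk; lia. }
destruct (R_complete s Hcau) as [l Hl]; exists l; split; [exact Hl |].
(* If the bound failed, a partial sum closer to [l] than the excess would violate [key] at [M = 1],
   since [s 2] is exactly the first-order part. *)
rewrite expE; apply Rnot_lt_le; intros Hlt.
destruct (Hl (Rabs (l - (a O + a 1%nat)) - e * t ^ 2) ltac:(lra)) as [N HN].
pose proof (HN (S (1 + N)) ltac:(lia)) as H1; unfold R_dist in H1.
pose proof (key 1%nat N ltac:(lia)) as H2.
assert (s2 : s 2%nat = a O + a 1%nat) by (rewrite !sS, s0; ring).
rewrite s2 in H2.
assert (0 <= E 1%nat).
{ pose proof (Epos O); pose proof (Epos 1%nat); unfold E; simpl sum_f_R0; lra. }
pose proof (Ele (1 + N)%nat).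
assert (t ^ 2 * (E (1 + N)%nat - E 1%nat) <= e * t ^ 2) by nra.
pose proof (Rabs_triang (l - s (S (1 + N))) (s (S (1 + N)) - (a O + a 1%nat))) as Htri.
replace (l - s (S (1 + N)) + (s (S (1 + N)) - (a O + a 1%nat)))
  with (l - (a O + a 1%nat)) in Htri by ring.
rewrite (Rabs_minus_sym _ l) in H1; lra.
Qed.

Module FixedPoints.

Import HB.structures.
Import all_boot all_order all_algebra.
Import sesquilinear spectral ring complex mxtens Rstruct.
Set Implicit Arguments. Unset Strict Implicit. Unset Printing Implicit Defensive.
Import Order.TTheory GRing.Theory Num.Theory.
Local Open Scope ring_scope.
Local Open Scope sesquilinear_scope.

(** * Positive matrices *)

Section Adjoint.
Variable C : numClosedFieldType.

Lemma adjM m n p (A : 'M[C]_(m, n)) (B : 'M_(n, p)) :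
  (A *m B)^t* = B^t* *m A^t*.
Proof. by rewrite trmx_mul map_mxM. Qed.

Lemma adjD m n (A B : 'M[C]_(m, n)) : (A + B)^t* = A^t* + B^t*.
Proof. by rewrite linearD /= map_mxD. Qed.

Lemma adjB m n (A B : 'M[C]_(m, n)) : (A - B)^t* = A^t* - B^t*.
Proof. by rewrite linearB /= map_mxB. Qed.

Lemma adjZ m n a (A : 'M[C]_(m, n)) : (a *: A)^t* = a^* *: A^t*.
Proof. by rewrite linearZ /= map_mxZ. Qed.

Lemma adj1 n : (1%:M : 'M[C]_n)^t* = 1%:M.
Proof. by rewrite trmx1 map_mx1. Qed.

Lemma adj_sum m n (I : finType) (F : I -> 'M[C]_(m, n)) :
  (\sum_i F i)^t* = \sum_i (F i)^t*.
Proof.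
elim/big_rec2: _ => [|i A B _ <-]; last by rewrite adjD.
by rewrite trmx0 map_mx0.
Qed.

Lemma trace_sqr m n (N : 'M[C]_(m, n)) :
  \tr (N *m N^t*) = \sum_i \sum_j `|N i j| ^+ 2.
Proof.
apply: eq_bigr => i _; rewrite mxE; apply: eq_bigr => j _.
by rewrite !mxE normCK.
Qed.

Lemma trace_sqr_eq0 m n (N : 'M[C]_(m, n)) : \tr (N *m N^t*) = 0 -> N = 0.
Proof.
rewrite trace_sqr => /eqP; rewrite psumr_eq0 => [|i _]; last first.
  by apply: sumr_ge0 => j _; rewrite exprn_ge0.
move=> /allP N0; apply/matrixP => i j; rewrite mxE.
have := N0 i (mem_index_enum _); rewrite psumr_eq0 => [/allP|k _]; last first.
  by rewrite exprn_ge0.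
by move=> /(_ j (mem_index_enum _)) /=; rewrite sqrf_eq0 normr_eq0 => /eqP.
Qed.

Lemma trace_diag_form m n (s : 'rV[C]_n) (N : 'M_(m, n)) :
  \tr (N *m diag_mx s *m N^t*) = \sum_i \sum_j s 0 j * `|N i j| ^+ 2.
Proof.
apply: eq_bigr => i _; rewrite mxE; apply: eq_bigr => j _.
by rewrite mul_mx_diag !mxE normCK mulrA [s 0 j * _]mulrC.
Qed.

Definition psdmx n (A : 'M[C]_n) := forall v : 'rV_n, 0 <= \tr (v *m A *m v^t*).

(** Polarization: nonnegative values are real, and reality of the form at [u + v] and at
    ['i *: u + v] makes it conjugate-symmetric. *)
Lemma psdmx_herm n (A : 'M[C]_n) : psdmx A -> A^t* = A.
Proof.
move=> psdA; pose q (u v : 'rV_n) := \tr (u *m A *m v^t*).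
have qDl u v w : q (u + v) w = q u w + q v w by rewrite /q !mulmxDl linearD.
have qDr u v w : q w (u + v) = q w u + q w v by rewrite /q adjD mulmxDr linearD.
have qZl a u v : q (a *: u) v = a * q u v.
  by rewrite /q -!scalemxAl linearZ.
have qZr a u v : q u (a *: v) = a^* * q u v.
  by rewrite /q adjZ -scalemxAr linearZ.
have q_real u : (q u u)^* = q u u by apply/CrealP/ger0_real/psdA.
have q_conj u v : (q u v)^* = q v u.
  have := q_real (u + v); rewrite !(qDl, qDr) !rmorphD /= !q_real.
  have := q_real ('i *: u + v); rewrite !(qDl, qDr, qZl, qZr).
  rewrite !(rmorphD, rmorphM) /= !q_real conjCK conjCi.
  move=> E2 E1.
  have {}E1 : (q u v)^* + (q v u)^* = q u v + q v u.
    by move: E1; rewrite -!addrA => /addrI; rewrite !addrA => /addIr.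
  have {}E2 : - (q u v)^* + (q v u)^* = q u v - q v u.
    apply: (mulfI (neq0Ci C)); apply/eqP; rewrite -subr_eq0.
    by move/eqP: E2; rewrite -subr_eq0; congr (_ == 0); ring.
  have E : (q u v)^* *+ 2 = q v u *+ 2.
    rewrite [RHS](_ : _ = (q u v + q v u) - (q u v - q v u)); last by ring.
    by rewrite -E1 -E2; ring.
  by apply/eqP; rewrite -(eqr_pMn2r (n := 2)) // E.
have qE i j : q (delta_mx 0 i) (delta_mx 0 j) = A i j.
  rewrite /q /mxtrace big_ord1 -rowE mxE (bigD1 j) //= big1 => [|k kj].
    by rewrite !mxE !eqxx conjC1 mulr1 addr0.
  by rewrite !mxE (negPf kj) andbF conjC0 mulr0.
by apply/matrixP => i j; rewrite !mxE -!qE q_conj.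
Qed.

Lemma psdmx_spectral n (A : 'M[C]_n) : psdmx A ->
  exists (U : 'M_n) (s : 'rV_n), [/\ U \is unitarymx, forall i, 0 <= s 0 i
                & A = U^t* *m diag_mx s *m U].
Proof.
move=> psdA; have hA := psdmx_herm psdA.
have /orthomx_spectralP A_eq : A \is normalmx by apply/normalmxP; rewrite hA.
have Uu := spectral_unitarymx A; rewrite invmx_unitary // in A_eq.
move: (spectralmx A) (spectral_diag A) A_eq Uu => U s A_eq Uu.
exists U, s; split => // i; have := psdA (row i U).
have rowU : row i U *m U^t* = delta_mx 0 i.
  by rewrite -row_mul (unitarymxP Uu) row1.
have -> : row i U *m A *m (row i U)^t* =
    row i U *m U^t* *m diag_mx s *m (row i U *m U^t*)^t*.
  by rewrite {1}A_eq adjM trmxCK !mulmxA.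
rewrite rowU trace_diag_form big_ord1 (bigD1 i) //= big1 => [|j ji].
  by rewrite mxE !eqxx normr1 expr1n mulr1 addr0.
by rewrite mxE (negPf ji) andbF normr0 expr0n mulr0.
Qed.

Lemma psdmx_factor n (A : 'M[C]_n) : psdmx A -> exists B : 'M_n, A = B^t* *m B.
Proof.
move=> /psdmx_spectral[U [s [_ s0 ->]]].
exists (diag_mx (\row_j sqrtC (s 0 j)) *m U); rewrite adjM !mulmxA.
congr (_ *m _); rewrite -mulmxA; congr (_ *m _).
rewrite tr_diag_mx map_diag_mx mulmx_diag; congr diag_mx.
apply/rowP => j; rewrite !mxE /= geC0_conj ?sqrtC_ge0 //.
by rewrite -expr2 sqrtCK.
Qed.

Lemma psdmx_congr m n (A : 'M[C]_n) (N : 'M_(m, n)) :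
  psdmx A -> psdmx (N *m A *m N^t*).
Proof. by move=> psdA v; have := psdA (v *m N); rewrite adjM !mulmxA. Qed.

Lemma psdmx_trace_ge0 n (A : 'M[C]_n) : psdmx A -> 0 <= \tr A.
Proof.
case/psdmx_factor=> B ->; rewrite mxtrace_mulC trace_sqr.
by do 2!apply: sumr_ge0 => ? _; rewrite exprn_ge0.
Qed.

(** With [A = B^* B] the trace is the squared Hilbert-Schmidt norm of [N B^*], so already
    [N B^* = 0]. *)
Lemma psdmx_trace0_mul m n (A : 'M[C]_n) (N : 'M_(m, n)) :
  psdmx A -> \tr (N *m A *m N^t*) = 0 -> N *m A = 0.
Proof.
case/psdmx_factor=> B ->; rewrite mulmxA -mulmxA -[B in _ *m (B *m _)]trmxCK -adjM.
by move/trace_sqr_eq0 ->; rewrite mul0mx.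
Qed.

(** [P] is the spectral projection of [A] onto its nonzero eigenvalues. Being a function of [A], it
    commutes with whatever commutes with [A]. *)
Lemma support_proj n (A : 'M[C]_n) : psdmx A -> exists P : 'M_n,
  [/\ P^t* = P, P *m P = P, forall X : 'M_n, X *m A = A *m X -> X *m P = P *m X,
      P *m A = A & forall m (N : 'M_(m, n)), N *m A = 0 -> N *m P = 0].
Proof.
move=> /psdmx_spectral[U [s [Uu s0 ->]]].
pose e : 'rV[C]_n := \row_j (s 0 j != 0)%:R.
have UU : U *m U^t* = 1%:M by apply/unitarymxP.
have UU' : U^t* *m U = 1%:M by apply: mulmx1C.
have conjU X Y : (U^t* *m X *m U) *m (U^t* *m Y *m U) = U^t* *m (X *m Y) *m U.
  by rewrite !mulmxA -[_ *m U *m _]mulmxA UU mulmx1 -!mulmxA.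
exists (U^t* *m diag_mx e *m U); split.
- rewrite !adjM trmxCK mulmxA tr_diag_mx map_diag_mx; congr (_ *m _ *m _).
  by congr diag_mx; apply/rowP => j; rewrite !mxE /= conjC_nat.
- rewrite conjU mulmx_diag; congr (_ *m _ *m _).
  by congr diag_mx; apply/rowP => j; rewrite !mxE -natrM mulnb andbb.
- move=> X; have -> : X = U^t* *m (U *m X *m U^t*) *m U.
    by rewrite !mulmxA UU' mul1mx -mulmxA UU' mulmx1.
  move: (U *m X *m U^t*) => {}X; rewrite !conjU.
  move=> /(congr1 (fun M => U *m M *m U^t*)) XA.
  rewrite !mulmxA UU !mul1mx -!mulmxA UU !mulmx1 in XA.
  congr (_ *m _ *m _); rewrite mul_mx_diag mul_diag_mx; apply/matrixP => i j.
  move/matrixP: XA => /(_ i j); rewrite mul_mx_diag mul_diag_mx !mxE.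
  (* Commuting with [diag_mx s] forces [X i j = 0] between distinct eigenvalues; between equal ones
     [e] takes equal values. *)
  have [->|nsij] := eqVneq (s 0 i) (s 0 j); first by move=> _; rewrite mulrC.
  move=> /eqP; rewrite mulrC -subr_eq0 -mulrBl mulf_eq0 subr_eq0 eq_sym (negPf nsij) /=.
  by move=> /eqP ->; rewrite mulr0 mul0r.
- rewrite conjU mulmx_diag; congr (_ *m _ *m _); congr diag_mx.
  apply/rowP => j; rewrite !mxE.
  by have [->|_] := eqVneq (s 0 j) 0; rewrite ?mulr0 ?mul1r.
- move=> m N /(congr1 (fun M => M *m U^t*)) NU.
  rewrite mul0mx -!mulmxA UU mulmx1 !mulmxA in NU.
  rewrite !mulmxA.
  suff -> : N *m U^t* *m diag_mx e = 0 by rewrite mul0mx.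
  apply/matrixP => i j.
  move/matrixP: NU => /(_ i j); rewrite !mul_mx_diag !mxE => /eqP.
  by rewrite mulf_eq0; case: eqP => [->|/eqP] ; [rewrite mul0r | move=> _ /= ->; rewrite mulr0].
Qed.

End Adjoint.

(** * Dephasing and invariant states *)

Section Dephasing.
Variable C : numClosedFieldType.

Definition comm n (A B : 'M[C]_n) := A *m B - B *m A.

Lemma comm0 n (A B : 'M[C]_n) : comm A B = 0 <-> A *m B = B *m A.
Proof. by rewrite /comm; split => [/subr0_eq|->]; rewrite ?subrr. Qed.

Lemma commDl n (A A' B : 'M[C]_n) : comm (A + A') B = comm A B + comm A' B.
Proof. by rewrite /comm mulmxDr mulmxDl opprD addrACA. Qed.

Lemma mulmx_commr n (N H Y : 'M[C]_n) : N *m H = H *m N ->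
  N *m comm H Y = comm H (N *m Y).
Proof. by move=> NH; rewrite /comm mulmxBr !mulmxA NH. Qed.

Lemma mulmx_comml n (N H Y : 'M[C]_n) : N *m H = H *m N ->
  comm H Y *m N = comm H (Y *m N).
Proof. by move=> NH; rewrite /comm mulmxBl -!mulmxA NH. Qed.

(** The commutator multiplies entry [(i, j)] by [d_i - d_j]. So matrices split into its kernel, the
    entries with [d_i = d_j], and its range, the other entries; [F] projects onto the first along
    the second. It is the algebraic form of the infinite-time average. *)
Lemma dephasing_diag n (d : 'rV[C]_n) : exists F : 'M[C]_n -> 'M[C]_n,
  [/\ forall X, comm (diag_mx d) (F X) = 0,
      forall X, comm (diag_mx d) X = 0 -> F X = X,
      forall X Y, F (X + comm (diag_mx d) Y) = F X,
      forall X, exists Y, X = F X + comm (diag_mx d) Y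
    & (forall X Y, \tr (F X *m Y) = \tr (X *m F Y)) /\
      (forall X, psdmx X -> psdmx (F X))].
Proof.
have commE Y i j : comm (diag_mx d) Y i j = (d 0 i - d 0 j) * Y i j.
  by rewrite /comm mul_mx_diag mul_diag_mx !mxE mulrBl [Y i j * _]mulrC.
exists (fun X => \matrix_(i, j) (if d 0 i == d 0 j then X i j else 0)).
split.
- move=> X; apply/matrixP => i j; rewrite commE !mxE.
  by case: eqP => [->|_]; rewrite ?subrr ?mul0r ?mulr0.
- move=> X /matrixP XD; apply/matrixP => i j; rewrite !mxE.
  have := XD i j; rewrite commE mxE => /eqP; rewrite mulf_eq0 subr_eq0.
  by case: eqP => //= _ /eqP.
- move=> X Y; apply/matrixP => i j; rewrite [LHS]mxE [RHS]mxE [(X + _) i j]mxE commE.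
  by case: eqP => // ->; rewrite subrr mul0r addr0.
(* Where [d_i = d_j] the inverse is 0 by convention, which is harmless because [F] keeps that
   entry. *)
- move=> X; exists (\matrix_(i, j) ((d 0 i - d 0 j)^-1 * X i j)).
  apply/matrixP => i j; rewrite [RHS]mxE commE !mxE.
  have [->|dij] := eqVneq; first by rewrite subrr mul0r addr0.
  by rewrite add0r mulrA divff ?mul1r // subr_eq0.
- split=> [X Y|X psdX v].
    apply: eq_bigr => i _; rewrite !mxE; apply: eq_bigr => j _; rewrite !mxE.
    by rewrite eq_sym; case: eqP; rewrite ?mul0r ?mulr0.
  (* [r] picks one index per eigenvalue, so that [F X] is the sum over [k] of
     the compressions of [X] to the spans of [r^-1(k)]. *)
  pose r (i : 'I_n) := index (d 0 i) [seq d 0 k | k : 'I_n].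
  have r_lt i : (r i < n)%N.
    by rewrite -[n in (_ < n)%N]card_ord -(size_image (d 0)) index_mem image_f.
  have rE i j : (d 0 i == d 0 j) = (r i == r j).
    apply/eqP/eqP => [|rij]; first by rewrite /r => ->.
    rewrite -[d 0 i](nth_index 0 (s := [seq d 0 k | k : 'I_n])) ?image_f //.
    by rewrite -/(r i) rij nth_index ?image_f.
  pose w k : 'rV[C]_n := \row_j (if r j == k then v 0 j else 0).
  suff -> : \tr (v *m (\matrix_(i, j) (if d 0 i == d 0 j then X i j else 0))
      *m v^t*) = \sum_(k < n) \tr (w k *m X *m (w k)^t*).
    by apply: sumr_ge0 => k _; exact: psdX.
  have formE (u : 'rV[C]_n) Z :
      \tr (u *m Z *m u^t*) = \sum_i \sum_j u 0 i * Z i j * (u 0 j)^*.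
    rewrite /mxtrace big_ord1 mxE exchange_big; apply: eq_bigr => j _.
    by rewrite mxE mulr_suml; apply: eq_bigr => i _; rewrite !mxE.
  rewrite formE (eq_bigr _ (fun (k : 'I_n) _ => formE (w k) X)) [RHS]exchange_big /=.
  apply: eq_bigr => i _; rewrite [RHS]exchange_big /=; apply: eq_bigr => j _.
  rewrite (bigD1 (Ordinal (r_lt i))) //= big1 => [|k ki].
    rewrite addr0 !mxE /= eqxx rE eq_sym.
    by case: eqP; rewrite ?conjC0 ?mulr0 ?mul0r.
  rewrite !mxE; case: eqP => [rik|_]; last by rewrite !mul0r.
  by case/eqP: ki; apply: val_inj.
Qed.

Lemma dephasing n (H : 'M[C]_n) : H^t* = H -> exists F : 'M[C]_n -> 'M[C]_n,
  [/\ forall X, comm H (F X) = 0,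
      forall X, comm H X = 0 -> F X = X,
      forall X Y, F (X + comm H Y) = F X,
      forall X, exists Y, X = F X + comm H Y
    & (forall X Y, \tr (F X *m Y) = \tr (X *m F Y)) /\
      (forall X, psdmx X -> psdmx (F X))].
Proof.
move=> hH; have /orthomx_spectralP : H \is normalmx by apply/normalmxP; rewrite hH.
have Uu := spectral_unitarymx H; rewrite invmx_unitary //.
move: (spectralmx H) (spectral_diag H) Uu => U d /unitarymxP UU HE.
have UU' : U^t* *m U = 1%:M by apply: mulmx1C.
pose K X := U *m X *m U^t*; pose K' X := U^t* *m X *m U.
have KK X : K (K' X) = X.
  by rewrite /K /K' !mulmxA UU mul1mx -mulmxA UU mulmx1.
have K'K X : K' (K X) = X.
  by rewrite /K /K' !mulmxA UU' mul1mx -mulmxA UU' mulmx1.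
have KM X Y : K (X *m Y) = K X *m K Y.
  by rewrite /K !mulmxA -[_ *m U^t* *m U]mulmxA UU' mulmx1.
have K'M X Y : K' (X *m Y) = K' X *m K' Y 
  by rewrite -{1}[X]KK -{1}[Y]KK -KM K'K.
have K'D X Y : K' (X + Y) = K' X + K' Y by rewrite /K' mulmxDr mulmxDl.
have KD X Y : K (X + Y) = K X + K Y by rewrite /K mulmxDr mulmxDl.
have KH : K H = diag_mx d by rewrite HE -/(K' _) KK.
have Kcomm X : K (comm H X) = comm (diag_mx d) (K X).
  by rewrite /comm -KH -!KM /K mulmxBr mulmxBl.
have K'comm X : K' (comm (diag_mx d) X) = comm H (K' X).
  by rewrite -{1}[X]KK -Kcomm K'K.
have K0 : K 0 = 0 by rewrite /K mulmx0 mul0mx.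
have K'0 : K' 0 = 0 by rewrite /K' mulmx0 mul0mx.
have K'tr X Y : \tr (K' X *m Y) = \tr (X *m K Y).
  by rewrite /K /K' -!mulmxA mxtrace_mulC !mulmxA.
have [F [F1 F2 F3 F4 [F5 F6]]] := dephasing_diag d.
exists (fun X => K' (F (K X))); split.
- by move=> X; rewrite -K'comm F1.
- by move=> X HX; rewrite F2 ?K'K // -Kcomm HX K0.
- by move=> X Y; rewrite KD Kcomm F3.
- move=> X; have [Y XY] := F4 (K X); exists (K' Y).
  by rewrite -K'comm -K'D -XY K'K.
- split=> [X Y|X psdX].
    by rewrite K'tr F5 [RHS]mxtrace_mulC K'tr mxtrace_mulC.
  have {}psdX : psdmx (F (K X)) by apply/F6/psdmx_congr.
  have := psdmx_congr (U^t*) psdX; rewrite trmxCK; exact.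
Qed.

(** Take [sigma = F rho] and let [P] be its support. [Phi] preserves both the kernel and the range
    of [comm H], hence commutes with [F], and the invariance of [rho] passes to [sigma] through the
    self-adjointness of [F]. *)
Lemma invariant_support n (H rho : 'M[C]_n) (Phi : 'M[C]_n -> 'M[C]_n) :
  H^t* = H -> psdmx rho ->
  (forall X Y, Phi (X + Y) = Phi X + Phi Y) ->
  (forall X, Phi (comm H X) = comm H (Phi X)) ->
  (forall X, \tr (rho *m Phi X) = \tr (rho *m X)) ->
  exists P sigma : 'M_n,
    [/\ P^t* = P, P *m P = P, P *m H = H *m P & P *m rho = rho] /\
    [/\ psdmx sigma, P *m sigma = sigma,
        forall X, \tr (sigma *m Phi X) = \tr (sigma *m X)
      & forall m (N : 'M_(m, n)), N *m sigma = 0 -> N *m P = 0].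
Proof.
move=> hH psd_rho PhiD Phi_comm rho_fix.
have [F [FH F_id F_inv F_dec [F_tr F_psd]]] := dephasing hH.
have psd_sigma := F_psd _ psd_rho.
have [P [hP PP P_comm P_sigma P_faith]] := support_proj psd_sigma.
have PH : P *m H = H *m P by symmetry; apply/P_comm/comm0/FH.
exists P, (F rho); split; split => //.
  have [N NE] : exists N, N = 1%:M - P by exists (1%:M - P).
  have NH : N *m H = H *m N by rewrite NE mulmxBl mulmxBr mul1mx mulmx1 PH.
  have hN : N^t* = N by rewrite NE adjB adj1 hP.
  (* Compression by [N], which commutes with [H], respects the splitting into kernel and range. *)
  have FN X : F (N *m X *m N) = N *m F X *m N.
    have [Y {1}->] := F_dec X.
    rewrite mulmxDr mulmxDl mulmx_commr // mulmx_comml // F_inv.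
    apply: F_id; rewrite -mulmx_comml // -mulmx_commr // FH.
    by rewrite mulmx0 mul0mx.
  (* [F] fixes the identity, hence preserves the trace, so this trace equals that of [N sigma N],
     which vanishes. Positivity of [rho] then gives [N rho = 0]. *)
  have : \tr (N *m rho *m N^t*) = 0.
    have comm1 : comm H 1%:M = 0 by rewrite /comm mulmx1 mul1mx subrr.
    rewrite hN -[X in \tr X]mulmx1 -(F_id _ comm1) -F_tr mulmx1 FN.
    by rewrite {1}NE mulmxBl mul1mx P_sigma subrr mul0mx mxtrace0.
  move/(psdmx_trace0_mul psd_rho); rewrite NE mulmxBl mul1mx => /subr0_eq.
  by [].
move=> X; have [Y XY] := F_dec X.
have FPhiF : comm H (Phi (F X)) = 0.
  rewrite -Phi_comm FH; apply: (addIr (Phi 0)).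
  by rewrite -PhiD !addr0 add0r.
rewrite !F_tr -[RHS]rho_fix; congr (\tr (_ *m _)).
by rewrite {1}XY PhiD Phi_comm F_inv F_id.
Qed.

End Dephasing.

(** * Fixed points of a channel and their commutant *)

(** The invariant functional [f] vanishes on the image [K (G - 1)] but not on [K]. That image is
    thus a proper subspace of [K], and by dimension count [G - 1] has a kernel on [K]. *)
Lemma fixed_vector (F : fieldType) m n p (K : 'M[F]_(m, n)) (G : 'M_n)
    (f : 'M_(n, p)) :
  (K *m G <= K)%MS -> K *m G *m f = K *m f -> K *m f != 0 ->
  exists z : 'rV_n, [/\ z != 0, (z <= K)%MS & z *m G = z].
Proof.
move=> KG_K KGf Kf; pose B := K *m (G - 1%:M).
have BK : (B <= K)%MS by rewrite /B mulmxBr mulmx1 addmx_sub // eqmx_opp.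
have ltBK : (\rank B < \rank K)%N.
  rewrite (ltn_leqif (mxrank_leqif_sup BK)); apply: contra Kf => /submxP[D ->].
  by rewrite -mulmxA /B mulmxBr mulmx1 mulmxBl KGf subrr mulmx0.
have : (K :&: kermx (G - 1%:M))%MS != 0.
  by rewrite -mxrank_eq0 -lt0n -(ltn_add2l (\rank B)) mxrank_mul_ker addn0.
case/rowV0Pn=> z; rewrite sub_capmx => /andP[zK /sub_kermxP] zG z0.
exists z; split=> //; apply/eqP.
by rewrite -subr_eq0; move: zG; rewrite mulmxBr mulmx1 => ->.
Qed.

Section KrausDual.
Variables (C : numClosedFieldType) (n d : nat) (I : finType).
Variable L : I -> 'M[C]_(n, d).

(** Heisenberg picture of the map with Kraus operators [L a], which sends states of dimension [d] to
    states of dimension [n]. *)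
Definition kraus_dual (X : 'M[C]_n) : 'M[C]_d := \sum_a (L a)^t* *m X *m L a.

Lemma kraus_dual_is_linear : linear kraus_dual.
Proof.
move=> c X Y; rewrite /kraus_dual scaler_sumr -big_split /=.
by apply: eq_bigr => a _; rewrite mulmxDr mulmxDl -scalemxAr -scalemxAl.
Qed.

HB.instance Definition _ := GRing.isLinear.Build C 'M[C]_n 'M[C]_d _ kraus_dual
  kraus_dual_is_linear.

Lemma kraus_dual_adj X : kraus_dual (X^t*) = (kraus_dual X)^t*.
Proof.
by rewrite adj_sum; apply: eq_bigr => a _; rewrite !adjM trmxCK mulmxA.
Qed.

End KrausDual.

Section CommLinear.
Variables (C : numClosedFieldType) (n : nat) (H : 'M[C]_n).

Lemma comm_is_linear : linear (comm H).
Proof.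
move=> c X Y; rewrite /comm mulmxDr mulmxDl -scalemxAr -scalemxAl scalerBr.
by rewrite opprD addrACA.
Qed.

HB.instance Definition _ := GRing.isLinear.Build C 'M[C]_n 'M[C]_n _ (comm H)
  comm_is_linear.

End CommLinear.

Section TraceForm.
Variables (C : numClosedFieldType) (n : nat) (rho : 'M[C]_n).

(** The value is a 1 by 1 matrix so that the functional has a matrix [lin_mx], as [fixed_vector]
    requires. *)
Definition trace_form (X : 'M[C]_n) : 'M[C]_1 := (\tr (rho *m X))%:M.

Lemma trace_form_is_linear : linear trace_form.
Proof.
move=> c X Y; rewrite /trace_form mulmxDr -scalemxAr linearD linearZ /=.
by rewrite raddfD /= scale_scalar_mx.
Qed.

HB.instance Definition _ := GRing.isLinear.Build C 'M[C]_n 'M[C]_1 _ trace_form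
  trace_form_is_linear.

End TraceForm.

Section Broadcasting.
Variables (C : numClosedFieldType) (n d : nat) (I : finType).
Variables (L : I -> 'M[C]_(n, d)) (pi : {linear 'M[C]_d -> 'M[C]_n}).
Variables (H rho : 'M[C]_d) (K : 'M[C]_n).
Hypotheses (L1 : kraus_dual L 1%:M = 1%:M)
  (piM : forall A B, pi (A *m B) = pi A *m pi B)
  (pi_adj : forall A, pi (A^t*) = (pi A)^t*)
  (pi_comm : forall A, pi (comm H A) = comm K (pi A))
  (L_comm : forall X, kraus_dual L (comm K X) = comm H (kraus_dual L X))
  (hH : H^t* = H) (psd_rho : psdmx rho)
  (rho_fix : forall A, \tr (rho *m kraus_dual L (pi A)) = \tr (rho *m A)).

(** In the application [pi] is [A] to [A *t 1], [K] is the total Hamiltonian, and [B] is an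
    observable of the second factor. *)
Lemma trace_kraus_dual_comm (B : 'M[C]_n) :
  (forall A, pi A *m B = B *m pi A) ->
  \tr (rho *m kraus_dual L (comm K B)) = 0.
Proof.
move=> piB.
have [P [sigma [[hP PP PH P_rho] [psd_sigma P_sigma sigma_fix P_faith]]]] :
  exists P sigma : 'M_d,
    [/\ P^t* = P, P *m P = P, P *m H = H *m P & P *m rho = rho] /\
    [/\ psdmx sigma, P *m sigma = sigma,
        forall A, \tr (sigma *m kraus_dual L (pi A)) = \tr (sigma *m A)
      & forall m (N : 'M_(m, d)), N *m sigma = 0 -> N *m P = 0].
  apply: invariant_support => // [X Y|X]; first by rewrite !linearD.
  by rewrite pi_comm L_comm.
have rho_P : rho *m P = rho.
  by rewrite -{1}(psdmx_herm psd_rho) -hP -adjM P_rho psdmx_herm.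
have sigma_P : sigma *m P = sigma.
  by rewrite -{1}(psdmx_herm psd_sigma) -hP -adjM P_sigma psdmx_herm.
pose M a := L a *m P.
have M_P a : M a *m P = M a by rewrite /M -mulmxA PP.
have ME X : kraus_dual M X = P *m kraus_dual L X *m P.
  rewrite /kraus_dual mulmx_sumr mulmx_suml; apply: eq_bigr => a _.
  by rewrite adjM hP !mulmxA.
clearbody M.
(* Compression to [P] is invisible to states supported in [P], so [rho] and [sigma] remain invariant
   under the compressed map. *)
have tr_M (tau : 'M_d) X : P *m tau = tau -> tau *m P = tau ->
    \tr (tau *m kraus_dual M X) = \tr (tau *m kraus_dual L X).
  by move=> Ptau tauP; rewrite ME mulmxA mxtrace_mulC !mulmxA Ptau tauP.
have M_comm X : kraus_dual M (comm K X) = comm H (kraus_dual M X).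
  by rewrite !ME L_comm mulmx_commr // mulmx_comml.
pose Psi := kraus_dual M \o pi.
have PsiE X : Psi X = kraus_dual M (pi X) by [].
have fix_adj A : Psi A = A -> Psi (A^t*) = A^t*.
  by rewrite !PsiE pi_adj kraus_dual_adj => ->.
have fix_P A : Psi A = A -> A *m P = A /\ P *m A = A.
  by rewrite !PsiE ME => <-; rewrite !mulmxA PP -!mulmxA PP.
have fix_intertwine A : Psi A = A -> forall a, pi A *m M a = M a *m A.
  move=> fixA; pose N a := pi A *m M a - M a *m A.
  have N_P a : N a *m P = N a.
    by rewrite /N mulmxBl -!mulmxA M_P; have [-> _] := fix_P A fixA.
  (* Expanding the square, the cross terms collapse because [A] and its adjoint are fixed; the last
     term contains [kraus_dual M 1 = P], which [A] absorbs. *)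
  have sumN : \sum_a (N a)^t* *m N a = Psi (A^t* *m A) - A^t* *m A.
    transitivity (Psi (A^t* *m A) - Psi (A^t*) *m A - A^t* *m Psi A
                  + A^t* *m kraus_dual M 1%:M *m A).
      rewrite !PsiE /kraus_dual !mulmx_sumr !mulmx_suml -!sumrB -big_split /=.
      apply: eq_bigr => a _; rewrite adjB !adjM -pi_adj piM mulmx1.
      by rewrite mulmxBl !mulmxBr !mulmxA opprB addrA addrAC.
    rewrite (fix_adj A fixA) fixA ME L1 mulmx1 PP -mulmxA (fix_P A fixA).2.
    by rewrite -addrA addNr addr0.
  (* The invariance of [sigma] cancels both terms of [sumN]. Each summand being nonnegative, every
     [N a] kills [sigma], hence [P], hence is 0. *)
  have : \sum_a \tr (N a *m sigma *m (N a)^t*) = 0.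
    transitivity (\tr (sigma *m \sum_a (N a)^t* *m N a)).
      rewrite mulmx_sumr linear_sum; apply: eq_bigr => a _.
      by rewrite -mulmxA mxtrace_mulC mulmxA.
    by rewrite sumN mulmxBr linearB /= tr_M // sigma_fix subrr.
  have N_ge0 a : 0 <= \tr (N a *m sigma *m (N a)^t*).
    by apply/psdmx_trace_ge0/psdmx_congr.
  move/eqP; rewrite psumr_eq0 // => /allP N0 a.
  apply/subr0_eq; rewrite -/(N a) -N_P; apply: P_faith.
  apply: (psdmx_trace0_mul psd_sigma); apply/eqP.
  exact: (N0 a (mem_index_enum _)).
have fix_intertwine_adj A : Psi A = A -> forall a,
    (M a)^t* *m pi A = A *m (M a)^t*.
  move=> fixA a; have E := fix_intertwine _ (fix_adj _ fixA) a.
  by rewrite -[pi A]trmxCK -adjM -pi_adj E adjM trmxCK.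
(* [A] is moved through [(M a)^*], [X] and [M a] in turn by the two intertwining relations. *)
have fix_comm A X : Psi A = A -> pi A *m X = X *m pi A ->
    A *m kraus_dual M X = kraus_dual M X *m A.
  move=> fixA AX; rewrite /kraus_dual mulmx_sumr mulmx_suml.
  apply: eq_bigr => a _; rewrite !mulmxA -fix_intertwine_adj //.
  by rewrite -!mulmxA -fix_intertwine // (mulmxA (pi A)) AX !mulmxA.
have Psi_comm X : Psi (comm H X) = comm H (Psi X).
  by rewrite !PsiE pi_comm M_comm.
have lin_Psi A : mxvec A *m lin_mx Psi = mxvec (Psi A) by exact: mul_vec_lin.
have lin_comm A : mxvec A *m lin_mx (comm H) = mxvec (comm H A).
  exact: mul_vec_lin.
have lin_tr A : mxvec A *m lin_mx (trace_form rho) = mxvec (trace_form rho A).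
  exact: mul_vec_lin.
(* Matrices are vectorized by [mxvec], which makes the fixed points a row space whose commutant is
   ['C(fixed)]. *)
pose fixed : 'A[C]_(d * d, d) := kermx (lin_mx Psi - 1%:M).
have fixedP A : reflect (Psi A = A) (A \in fixed)%MS.
  apply: (iffP sub_kermxP); rewrite mulmxBr mulmx1 lin_Psi.
    by move=> /subr0_eq /(can_inj mxvecK).
  by move=> ->; rewrite subrr.
pose V := ('C(fixed) *m lin_mx (comm H))%MS.
have cent_Psi X : (X \in 'C(fixed))%MS -> (Psi X \in 'C(fixed))%MS.
  move=> /cent_mxP cX; apply/cent_mxP => A /fixedP fixA.
  by apply: fix_comm => //; rewrite -!piM cX //; apply/fixedP.
have cent_MB : (kraus_dual M B \in 'C(fixed))%MS.
  by apply/cent_mxP => A /fixedP fixA; apply: fix_comm.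
apply/eqP/negPn/negP => trB.
(* The three conditions are: [V] is stable, because [Psi] commutes with [comm H] and preserves the
   commutant; [tr (rho .)] is [Psi]-invariant; and it is nonzero on [V], witnessed by
   [comm H (kraus_dual M B)]. *)
have [|||z [z0 zV zPsi]] := @fixed_vector _ _ _ _ V (lin_mx Psi)
  (lin_mx (trace_form rho)).
- have adPsi : lin_mx (comm H) *m lin_mx Psi = lin_mx Psi *m lin_mx (comm H).
    apply/row_matrixP => i; rewrite !rowE -[delta_mx 0 i]vec_mxK !mulmxA.
    by rewrite lin_Psi !lin_comm lin_Psi Psi_comm.
  rewrite /V -mulmxA adPsi mulmxA; apply: submxMr.
  apply/rV_subP => v /submxP[u ->].
  rewrite mulmxA -[u *m _]vec_mxK lin_Psi; apply: cent_Psi.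
  by rewrite vec_mxK submxMl.
- rewrite -mulmxA; congr (_ *m _).
  apply/row_matrixP => i; rewrite !rowE -[delta_mx 0 i]vec_mxK !mulmxA.
  by rewrite lin_Psi !lin_tr /trace_form PsiE tr_M // rho_fix.
- apply: contra trB => /eqP Vf; have /submxP[D DE] := cent_MB.
  have : mxvec (kraus_dual M B) *m lin_mx (comm H) *m lin_mx (trace_form rho)
      = D *m (V *m lin_mx (trace_form rho)) by rewrite DE /V !mulmxA.
  rewrite Vf mulmx0 lin_comm lin_tr => /eqP; rewrite mxvec_eq0.
  move=> /eqP/matrixP/(_ 0 0).
  by rewrite !mxE mulr1n -M_comm tr_M // => /eqP.
have [D zE] : exists D, z = mxvec (comm H D) /\ (D \in 'C(fixed))%MS.
  case/submxP: zV => u ->; exists (vec_mx (u *m 'C(fixed)%MS)).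
  by rewrite -lin_comm vec_mxK mulmxA submxMl.
case: zE => {}zE cD; rewrite {z}zE in z0 zPsi zV.
case/negP: z0; rewrite mxvec_eq0; apply/eqP/trace_sqr_eq0.
have fixZ : Psi (comm H D) = comm H D.
  by apply: (can_inj mxvecK); rewrite -lin_Psi.
(* With [Z = comm H D], the adjoint of [Z] is also fixed, so [D] commutes with it, and cyclicity
   gives [tr (H D Z^* ) = tr (D H Z^* )]. *)
have /cent_mxP/(_ ((comm H D)^t*)) ZD := cD.
rewrite {1}/comm mulmxBl linearB /= -mulmxA -ZD; last first.
  by apply/fixedP/fix_adj.
by rewrite -[X in _ - \tr X]mulmxA [X in _ - X]mxtrace_mulC -!mulmxA subrr.
Qed.
End Broadcasting.

(** * First-order expansions *)

Section Jets.
Variable R : rcfType.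
Local Notation C := R[i].
Local Notation "x %:C" := (real_complex R x) : ring_scope.

(** First-order Taylor data [f(0) = a], [f'(0) = b] with an explicit quadratic remainder on
    [|t| <= 1], the form in which the exponential series supplies it. *)
Definition jet (f : R -> C) (a b : C) := exists2 M : C, 0 <= M &
  forall t : R, `|t| <= 1 -> `|f t - (a + t%:C * b)| <= M * (t ^+ 2)%:C.

Lemma norm_real_complex (t : R) : `|t%:C| = `|t|%:C :> C.
Proof. by rewrite normc_def /= expr0n addr0 sqrtr_sqr. Qed.

Lemma jet_ext f g a b : jet f a b -> f =1 g -> jet g a b.
Proof. by case=> M M0 HM fg; exists M => // t /HM; rewrite fg. Qed.

Lemma jet_cst a : jet (fun=> a) a 0.
Proof. by exists 0 => // t _; rewrite mulr0 addr0 subrr normr0 mul0r. Qed.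

Lemma jetD f g a b a' b' : jet f a b -> jet g a' b' ->
  jet (fun t => f t + g t) (a + a') (b + b').
Proof.
case=> M M0 HM [M' M'0 HM']; exists (M + M'); first exact: addr_ge0.
move=> t t1; rewrite mulrDl.
apply: le_trans (lerD (HM t t1) (HM' t t1)).
rewrite [X in `|X|](_ : _ = (f t - (a + t%:C * b)) + (g t - (a' + t%:C * b'))).
  exact: ler_normD.
by ring.
Qed.

Lemma jet_sum (I : finType) (f : I -> R -> C) a b :
  (forall i, jet (f i) (a i) (b i)) ->
  jet (fun t => \sum_i f i t) (\sum_i a i) (\sum_i b i).
Proof.
move=> Hf; elim: (index_enum I) => [|i r IH].
  by rewrite !big_nil; apply: (jet_ext (jet_cst 0)) => t; rewrite big_nil.
rewrite !big_cons /=; apply: (jet_ext (jetD (Hf i) IH)) => t.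
by rewrite big_cons /=.
Qed.

Lemma jetM f g a b a' b' : jet f a b -> jet g a' b' ->
  jet (fun t => f t * g t) (a * a') (a * b' + b * a').
Proof.
case=> M M0 HM [M' M'0 HM'].
(* With remainders [r], [r'], the error of the product is [t^2 b b' + r g + (a + t b) r']; the three
   summands bound these terms. *)
exists (`|b * b'| + M * (`|a'| + `|b'| + M') + (`|a| + `|b|) * M').
  by rewrite !addr_ge0 ?mulr_ge0 ?addr_ge0.
move=> t t1; pose r := f t - (a + t%:C * b); pose r' := g t - (a' + t%:C * b').
have Hr : `|r| <= M * (t ^+ 2)%:C := HM t t1.
have Hr' : `|r'| <= M' * (t ^+ 2)%:C := HM' t t1.
have t0 : (0 : C) <= (t ^+ 2)%:C by rewrite ler0c sqr_ge0.
have t21 : (t ^+ 2)%:C <= (1 : C).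
  by rewrite -[1]/(1%:C) lecR -real_normK ?num_real // exprn_ile1.
have tn1 : `|t%:C| <= (1 : C) by rewrite norm_real_complex -[1]/(1%:C) lecR.
have lin_le (x y : C) : `|x + t%:C * y| <= `|x| + `|y|.
  by apply: le_trans (ler_normD _ _) _; rewrite lerD2l normrM ler_piMl.
have Hg : `|g t| <= `|a'| + `|b'| + M'.
  have -> : g t = (a' + t%:C * b') + r' by rewrite addrC subrK.
  apply: le_trans (ler_normD _ _) _; apply: lerD => //.
  by apply: le_trans Hr' _; rewrite ler_piMr.
have -> : f t * g t - (a * a' + t%:C * (a * b' + b * a')) =
    (t ^+ 2)%:C * (b * b') + r * g t + (a + t%:C * b) * r'.
  by rewrite /r /r' rmorphXn /=; ring.
apply: le_trans (ler_normD _ _) _; rewrite [X in _ <= X]mulrDl; apply: lerD.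
  apply: le_trans (ler_normD _ _) _; rewrite [X in _ <= X]mulrDl; apply: lerD.
    by rewrite normrM (ger0_norm t0) mulrC.
  by rewrite normrM mulrAC; apply: ler_pM.
by rewrite normrM -mulrA; apply: ler_pM.
Qed.

Lemma jet_conj f a b : jet f a b -> jet (fun t => (f t)^*) a^* b^*.
Proof.
case=> M M0 HM; exists M => // t t1; apply: le_trans (HM t t1).
rewrite -[X in _ <= X]norm_conjC rmorphB rmorphD rmorphM /=.
have /CrealP -> // : t%:C \is Num.real by rewrite complex_real.
Qed.

Lemma jet_uniq f a b a' b' : jet f a b -> jet f a' b' -> b = b'.
Proof.
case=> M M0 HM [M' M'0 HM'].
have a_eq x N y : (forall t : R, `|t| <= 1 ->
    `|f t - (x + t%:C * y)| <= N * (t ^+ 2)%:C) -> f 0 = x.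
  move=> /(_ 0); rewrite normr0 ler01 => /(_ isT).
  rewrite expr0n mulr0 mul0r addr0 normr_le0 subr_eq0.
  by move=> /eqP.
have aa' : a = a' by rewrite -(a_eq _ _ _ HM) -(a_eq _ _ _ HM').
subst a'; apply/eqP/negPn/negP => bb'.
have [dl dlE] : exists dl : R, `|b - b'| = dl%:C.
  by apply/complex_realP; rewrite ger0_real.
have [N NE] : exists N : R, M + M' = N%:C.
  by apply/complex_realP; rewrite ger0_real // addr_ge0.
have N0 : 0 <= N by rewrite -ler0c -NE addr_ge0.
have dl_gt0 : 0 < dl by rewrite -ltcR -dlE normr_gt0 subr_eq0.
(* The two expansions give [t dl <= N t^2], that is [dl <= N t]. This [t] lies in [(0, 1]] and has
   [N t < dl], also when [N = 0]. *)
pose t := dl / (dl + 2 * N).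
have den_gt0 : 0 < dl + 2 * N by rewrite ltr_wpDr ?mulr_ge0.
have t_gt0 : 0 < t by rewrite divr_gt0.
have t1 : `|t| <= 1.
  by rewrite gtr0_norm // ler_pdivrMr // mul1r lerDl mulr_ge0.
have : `|t%:C * (b - b')| <= (M + M') * (t ^+ 2)%:C.
  have -> : t%:C * (b - b') =
      (f t - (a + t%:C * b')) - (f t - (a + t%:C * b)) by ring.
  by apply: le_trans (ler_normB _ _) _; rewrite addrC mulrDl lerD // ?HM ?HM'.
rewrite normrM norm_real_complex dlE NE gtr0_norm // -!rmorphM lecR.
rewrite expr2 mulrCA ler_pM2l // /t mulrA ler_pdivlMr // [N * _]mulrC.
rewrite ler_pM2l //; apply/negP; rewrite -ltNge.
by rewrite mulr_natl mulr2n addrA ltr_wpDr // ltrDr.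
Qed.

Definition mjet m n (F : R -> 'M[C]_(m, n)) (A B : 'M[C]_(m, n)) :=
  forall i j, jet (fun t => F t i j) (A i j) (B i j).

Lemma mjet_ext m n F G (A B : 'M[C]_(m, n)) : mjet F A B ->
  (forall t, `|t| <= 1 -> F t = G t) -> mjet G A B.
Proof.
move=> HF FG i j; have [M M0 HM] := HF i j; exists M => // t t1.
by rewrite -FG // HM.
Qed.

Lemma mjet_cst m n (A : 'M[C]_(m, n)) : mjet (fun=> A) A 0.
Proof. by move=> i j; rewrite mxE; apply: jet_cst. Qed.

Lemma mjetM m n p F G (A B : 'M[C]_(m, n)) (A' B' : 'M[C]_(n, p)) :
  mjet F A B -> mjet G A' B' ->
  mjet (fun t => F t *m G t) (A *m A') (A *m B' + B *m A').
Proof.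
move=> HF HG i j; rewrite !mxE -big_split /=.
apply: (jet_ext (jet_sum (fun k => jetM (HF i k) (HG k j)))) => t.
by rewrite mxE.
Qed.

Lemma mjet_adj m n F (A B : 'M[C]_(m, n)) : mjet F A B ->
  mjet (fun t => (F t)^t*) (A^t*) (B^t*).
Proof.
move=> HF i j; rewrite !mxE; apply: (jet_ext (jet_conj (HF j i))) => t.
by rewrite !mxE.
Qed.

Lemma mjet_tens m n p q F G (A B : 'M[C]_(m, n)) (A' B' : 'M[C]_(p, q)) :
  mjet F A B -> mjet G A' B' ->
  mjet (fun t => F t *t G t) (A *t A') (A *t B' + B *t A').
Proof.
move=> HF HG i j; rewrite !mxE; apply: (jet_ext (jetM (HF _ _) (HG _ _))) => t.
by rewrite !mxE.
Qed.

Lemma mjet_linear m n p q (E : {linear 'M[C]_(m, n) -> 'M[C]_(p, q)}) F A B :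
  mjet F A B -> mjet (fun t => E (F t)) (E A) (E B).
Proof.
have EE X i j : E X i j = \sum_k \sum_l X k l * E (delta_mx k l) i j.
  rewrite {1}[X]matrix_sum_delta linear_sum summxE; apply: eq_bigr => k _.
  rewrite linear_sum summxE; apply: eq_bigr => l _.
  by rewrite linearZ mxE.
move=> HF i j; rewrite !EE.
have Hkl k l : jet (fun t => F t k l * E (delta_mx k l) i j)
    (A k l * E (delta_mx k l) i j) (B k l * E (delta_mx k l) i j).
  by have := jetM (HF k l) (jet_cst (E (delta_mx k l) i j)); rewrite mulr0 add0r.
apply: (jet_ext (jet_sum (fun k => jet_sum (fun l => Hkl k l)))) => t.
by rewrite EE.
Qed.

(** Conjugation by [V t *t W t] has first-order term [- 'i *: comm K Y]. A linear [E] acts on jets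
    termwise, so uniqueness of the first-order term on both sides of the covariance relation gives
    the claim. *)
Lemma covariance_deriv m n (HR : 'M[C]_m) (HS : 'M[C]_n)
    (V : R -> 'M[C]_m) (W : R -> 'M[C]_n)
    (E : {linear 'M[C]_(m * n) -> 'M[C]_(m * n)}) :
  HR^t* = HR -> HS^t* = HS ->
  mjet V 1%:M (- 'i *: HR) -> mjet W 1%:M (- 'i *: HS) ->
  (forall t X, `|t| <= 1 -> E (V t *t W t *m X *m (V t *t W t)^t*) =
               V t *t W t *m E X *m (V t *t W t)^t*) ->
  let K := HR *t 1%:M + 1%:M *t HS in
  forall X, E (comm K X) = comm K (E X).
Proof.
move=> hR hS HV HW cov K X.
have hK : K^t* = K.
  by rewrite adjD !trmx_tens !map_mxT !hR !hS !adj1.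
have HU := mjet_tens HV HW.
have tens11 : (1%:M : 'M[C]_m) *t (1%:M : 'M[C]_n) = 1%:M.
  apply/matrixP => i j; rewrite !mxE -natrM mulnb; congr (nat_of_bool _)%:R.
  by rewrite -[RHS](can_eq (@mxtens_unindexK m n)) xpair_eqE.
have GE : 1%:M *t (- 'i *: HS) + (- 'i *: HR) *t 1%:M = - 'i *: K.
  by rewrite /K scalerDr addrC; congr (_ + _); apply/matrixP => i j; rewrite !mxE; ring.
rewrite tens11 GE in HU.
have ci : (- 'i : C)^* = 'i by rewrite rmorphN /= conjCi opprK.
have HAd Y : mjet (fun t => V t *t W t *m Y *m (V t *t W t)^t*) Y (- 'i *: comm K Y).
  have := mjetM (mjetM HU (mjet_cst Y)) (mjet_adj HU).
  rewrite adj1 mul1mx !mulmx1 mulmx0 add0r adjZ hK ci.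
  suff -> : Y *m ('i *: K) + (- 'i *: K) *m Y = - 'i *: comm K Y by [].
  by rewrite /comm scalerBr !scaleNr opprK -scalemxAr mulNmx -scalemxAl addrC.
have H1 := mjet_linear E (HAd X).
have H2 := mjet_ext (HAd (E X)) (fun t t1 => esym (cov t X t1)).
have : E (- 'i *: comm K X) = - 'i *: comm K (E X).
  by apply/matrixP => i j; apply: jet_uniq (H1 i j) (H2 i j).
by rewrite linearZ /= => /scalerI -> //; rewrite oppr_eq0 neq0Ci.
Qed.

End Jets.

(** * Channels on a tensor product *)

Section TensorTrace.
Variable C : numClosedFieldType.

Lemma tensmxBl m n p q (A A' : 'M[C]_(m, n)) (B : 'M[C]_(p, q)) :
  (A - A') *t B = A *t B - A' *t B.
Proof. by apply/matrixP => i j; rewrite !mxE mulrBl. Qed.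

Lemma tensmxBr m n p q (A : 'M[C]_(m, n)) (B B' : 'M[C]_(p, q)) :
  A *t (B - B') = A *t B - A *t B'.
Proof. by apply/matrixP => i j; rewrite !mxE mulrBr. Qed.

Lemma tensmx_adj m n p q (A : 'M[C]_(m, n)) (B : 'M[C]_(p, q)) :
  (A *t B)^t* = A^t* *t B^t*.
Proof. by rewrite trmx_tens map_mxT. Qed.

Lemma trace_tensmx m n (A : 'M[C]_m) (B : 'M[C]_n) :
  \tr (A *t B) = \tr A * \tr B.
Proof. by rewrite mulr_sum; apply: eq_bigr => i _; rewrite mxE. Qed.

Lemma comm_tensl m n (H A : 'M[C]_m) (B : 'M[C]_n) :
  comm (H *t 1%:M) (A *t B) = comm H A *t B.
Proof. by rewrite /comm !tensmx_mul mulmx1 mul1mx tensmxBl. Qed.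

Lemma comm_tensr m n (H B : 'M[C]_n) (A : 'M[C]_m) :
  comm (1%:M *t H) (A *t B) = A *t comm H B.
Proof. by rewrite /comm !tensmx_mul mulmx1 mul1mx tensmxBr. Qed.

Lemma trace_comm n (H A B : 'M[C]_n) :
  \tr (A *m comm H B) = - \tr (comm H A *m B).
Proof.
rewrite /comm mulmxBr mulmxBl !linearB /= opprB !mulmxA; congr (_ - _).
by rewrite mxtrace_mulC !mulmxA.
Qed.

Lemma trace_inj n (A B : 'M[C]_n) :
  (forall X, \tr (X *m A) = \tr (X *m B)) -> A = B.
Proof.
move=> AB; apply/subr0_eq/trace_sqr_eq0.
by rewrite mxtrace_mulC mulmxBr linearB /= AB subrr.
Qed.

Definition right_tens1 m n (A : 'M[C]_m) : 'M[C]_(m * n) := A *t 1%:M.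

Lemma right_tens1_is_linear m n : linear (@right_tens1 m n).
Proof. by move=> c A B; apply/matrixP => i j; rewrite !mxE mulrDl mulrA. Qed.

HB.instance Definition _ m n := GRing.isLinear.Build C 'M[C]_m 'M[C]_(m * n) _
  (@right_tens1 m n) (@right_tens1_is_linear m n).

End TensorTrace.

Section NoBroadcasting.
Variables (C : numClosedFieldType) (m n : nat) (I : finType).
Variables (K : I -> 'M[C]_(m * n)) (E : 'M[C]_(m * n) -> 'M[C]_(m * n)).
Variables (HR rhoR : 'M[C]_m) (HS rhoS : 'M[C]_n).
Hypotheses (EK : forall X, E X = \sum_a K a *m X *m (K a)^t*)
  (E_tr : forall X, \tr (E X) = \tr X)
  (hHR : HR^t* = HR)
  (psd_rhoR : psdmx rhoR) (psd_rhoS : psdmx rhoS) (tr_rhoS : \tr rhoS = 1)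
  (HS_rhoS : comm HS rhoS = 0).
Let H := HR *t 1%:M + 1%:M *t HS : 'M[C]_(m * n).
Hypotheses (E_comm : forall X, E (comm H X) = comm H (E X))
  (E_fix : forall A, \tr (E (rhoR *t rhoS) *m (A *t 1%:M)) = \tr (rhoR *m A)).

(** [trace_kraus_dual_comm] is applied to the channel [X] to [E (X *t rhoS)], with [1 *t B] as the
    observable. *)
Lemma no_broadcasting_trace (B : 'M[C]_n) :
  \tr (E (rhoR *t rhoS) *m (1%:M *t comm HS B)) = 0.
Proof.
have [S SE] := psdmx_factor psd_rhoS.
(* [J k] is the identity tensored with the [k]-th column of [S^*]. As [rhoS = S^* S], these are
   Kraus operators for attaching [rhoS]. *)
pose J k : 'M[C]_(m * n, m) := \matrix_(p, i)
  (((mxtens_unindex p).1 == i)%:R * (S k (mxtens_unindex p).2)^*).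
have JE X : \sum_k J k *m X *m (J k)^t* = X *t rhoS.
  apply/matrixP => p q; rewrite summxE SE !mxE mulr_sumr.
  apply: eq_bigr => k _; rewrite mxE (bigD1 (mxtens_unindex q).1) //= big1.
    rewrite mxE (bigD1 (mxtens_unindex p).1) //= big1 => [|i ip].
      by rewrite !mxE !eqxx /= !mul1r conjCK !addr0; ring.
    by rewrite mxE eq_sym (negPf ip) !mul0r.
  by move=> i iq; rewrite !mxE eq_sym (negPf iq) mul0r conjC0 mulr0.
pose L (ak : I * 'I_n) := K ak.1 *m J ak.2.
have L_tr X Y : \tr (X *m kraus_dual L Y) = \tr (E (X *t rhoS) *m Y).
  rewrite /kraus_dual EK mulmx_sumr mulmx_suml !linear_sum -(pair_bigA _
    (fun a k => \tr (X *m ((L (a, k))^t* *m Y *m L (a, k))))) /=.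
  apply: eq_bigr => a _; rewrite -JE mulmx_sumr !mulmx_suml linear_sum.
  apply: eq_bigr => k _; rewrite /L /= adjM mulmxA mxtrace_mulC !mulmxA.
  by rewrite -!mulmxA.
(* Since [rhoS] commutes with [HS], attaching it intertwines [comm HR] with [comm H]; by duality
   [kraus_dual L] intertwines them in the other direction. *)
have commH X : comm H (X *t rhoS) = comm HR X *t rhoS.
  by rewrite commDl comm_tensl comm_tensr HS_rhoS tensmx0 addr0.
have comm1 k (A : 'M[C]_k) : comm A 1%:M = 0.
  by rewrite /comm mulmx1 mul1mx subrr.
have <- : comm H (1%:M *t B) = 1%:M *t comm HS B.
  by rewrite commDl comm_tensl comm_tensr comm1 tens0mx add0r.
rewrite -L_tr.
apply: (@trace_kraus_dual_comm _ _ _ _ L (@right_tens1 C m n) HR) => //.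
- by apply: trace_inj => X; rewrite L_tr !mulmx1 E_tr trace_tensmx tr_rhoS mulr1.
- by move=> A A'; rewrite /right_tens1 tensmx_mul mulmx1.
- by move=> A; rewrite /right_tens1 tensmx_adj adj1.
- by move=> A; rewrite /right_tens1 commDl comm_tensl comm_tensr comm1 tensmx0 addr0.
- move=> Y; apply: trace_inj => X.
  by rewrite L_tr !trace_comm -E_comm commH L_tr.
- by move=> A; rewrite L_tr E_fix.
- by move=> A; rewrite /right_tens1 !tensmx_mul !mulmx1 !mul1mx.
Qed.

End NoBroadcasting.

(** * Entrywise complex matrices as MathComp matrices *)

Section Entries.
Local Notation C := R[i].

Definition cplx (z : Defs.C) : C := Complex z.1 z.2.
Definition uncplx (z : C) : Defs.C := (complex.Re z, complex.Im z).

Lemma uncplxK : cancel uncplx cplx. Proof. by case. Qed.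
Lemma cplxK : cancel cplx uncplx. Proof. by case. Qed.

Lemma cplxD x y : cplx (Cadd x y) = cplx x + cplx y. Proof. by []. Qed.
Lemma cplxM x y : cplx (Cmul x y) = cplx x * cplx y. Proof. by []. Qed.
Lemma cplxJ x : cplx (Cconj x) = (cplx x)^*. Proof. by []. Qed.

Lemma cplx_sum n f : cplx (Csum n f) = \sum_(i < n) cplx (f i).
Proof.
by elim: n => [|n IH]; rewrite ?big_ord0 // big_ord_recr /= cplxD IH.
Qed.

Definition mx_of m n (A : Mat) : 'M[C]_(m, n) := \matrix_(i, j) cplx (A i j).

Definition of_mx m n (A : 'M[C]_(m, n)) : Mat := fun i j =>
  if (insub i, insub j) is (Some i', Some j') then uncplx (A i' j') else Defs.C0.

Lemma of_mxK m n : cancel (@of_mx m n) (@mx_of m n).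
Proof.
move=> A; apply/matrixP => i j; rewrite mxE /of_mx !valK.
exact: uncplxK.
Qed.

Lemma meqP n A B : meq n A B <-> mx_of n n A = mx_of n n B.
Proof.
split=> [AB|/matrixP AB i j /ssrnat.ltP lt_in /ssrnat.ltP lt_jn].
  by apply/matrixP => i j; rewrite !mxE AB //; apply/ssrnat.ltP.
have := AB (Ordinal lt_in) (Ordinal lt_jn); rewrite !mxE.
exact: (can_inj cplxK).
Qed.

Lemma mx_of_mul m n p A B : mx_of m p (mmul n A B) = mx_of m n A *m mx_of n p B.
Proof.
apply/matrixP => i j; rewrite !mxE cplx_sum; apply: eq_bigr => k _.
by rewrite !mxE.
Qed.

Lemma mx_of_adj m n A : mx_of m n (madj A) = (mx_of n m A)^t*.
Proof. by apply/matrixP => i j; rewrite !mxE. Qed.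

Lemma mx_of_scale m n c A : mx_of m n (mscale c A) = cplx c *: mx_of m n A.
Proof. by apply/matrixP => i j; rewrite !mxE. Qed.

Lemma mx_of_add m n A B : mx_of m n (madd A B) = mx_of m n A + mx_of m n B.
Proof. by apply/matrixP => i j; rewrite !mxE. Qed.

Lemma mx_of_id n : mx_of n n mid = 1%:M.
Proof.
apply/matrixP => i j; rewrite !mxE /mid.
case: (Nat.eqb_spec i j) => [/val_inj ->|ij]; first by rewrite eqxx.
by case: eqP => // eij; case: ij; rewrite eij.
Qed.

Lemma mx_of_trace n A : cplx (mtrace n A) = \tr (mx_of n n A).
Proof. by rewrite cplx_sum; apply: eq_bigr => i _; rewrite mxE. Qed.

Lemma Nat_divmod a b q r : (r < b)%N -> a = (q * b + r)%N ->
  Nat.div a b = q /\ Nat.modulo a b = r.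
Proof.
move=> /ssrnat.ltP rb ->; rewrite -plusE -multE; split.
  by symmetry; apply: (PeanoNat.Nat.div_unique _ _ _ r) => //; rewrite PeanoNat.Nat.mul_comm.
by symmetry; apply: (PeanoNat.Nat.mod_unique _ _ q) => //; rewrite PeanoNat.Nat.mul_comm.
Qed.

(** Both conventions number the pair [(i, j)] by [i * n + j]. *)
Lemma Nat_divE m n (p : 'I_(m * n)) : Nat.div p n = (mxtens_unindex p).1 :> nat.
Proof.
case: (mxtens_indexP p) => i j; rewrite mxtens_indexK.
by case: (@Nat_divmod (mxtens_index (i, j)) n i j).
Qed.

Lemma Nat_modE m n (p : 'I_(m * n)) : Nat.modulo p n = (mxtens_unindex p).2 :> nat.
Proof.
case: (mxtens_indexP p) => i j; rewrite mxtens_indexK.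
by case: (@Nat_divmod (mxtens_index (i, j)) n i j).
Qed.

Lemma mx_of_kron m n A B :
  mx_of (m * n) (m * n) (kron n A B) = mx_of m m A *t mx_of n n B.
Proof.
by apply/matrixP => p q; rewrite !mxE /kron !Nat_divE !Nat_modE.
Qed.

Lemma big_mxtens (V : nmodType) m n (F : 'I_(m * n) -> V) :
  \sum_p F p = \sum_i \sum_j F (mxtens_index (i, j)).
Proof.
rewrite pair_big (reindex (@mxtens_index m n)) /=.
  by apply: eq_bigr => [[]].
by exists (@mxtens_unindex m n) => ? _; rewrite ?mxtens_indexK ?mxtens_unindexK.
Qed.

Lemma mul_tensl_entry m n (M : 'M[C]_(m * n)) (A : 'M[C]_m) p i k :
  (M *m (A *t 1%:M)) p (mxtens_index (i, k)) =
  \sum_j M p (mxtens_index (j, k)) * A j i.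
Proof.
rewrite mxE big_mxtens; apply: eq_bigr => j _.
rewrite (bigD1 k) //= big1 => [|l lk]; rewrite tensmxE mxE.
  by rewrite eqxx mulr1 addr0.
by rewrite (negPf lk) !mulr0.
Qed.

Lemma mul_tensr_entry m n (M : 'M[C]_(m * n)) (B : 'M[C]_n) p i k :
  (M *m (1%:M *t B)) p (mxtens_index (i, k)) =
  \sum_l M p (mxtens_index (i, l)) * B l k.
Proof.
rewrite mxE big_mxtens exchange_big; apply: eq_bigr => l _.
rewrite (bigD1 i) //= big1 => [|j ji]; rewrite tensmxE mxE.
  by rewrite eqxx mul1r addr0.
by rewrite (negPf ji) mul0r mulr0.
Qed.

Lemma trace_mul_tensl m n X (A : 'M[C]_m) :
  \tr (mx_of (m * n) (m * n) X *m (A *t 1%:M)) =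
  \tr (mx_of m m (ptraceS m n X) *m A).
Proof.
rewrite [LHS]big_mxtens; apply: eq_bigr => i _.
under eq_bigr => k _ do rewrite mul_tensl_entry.
rewrite exchange_big [RHS]mxE; apply: eq_bigr => j _.
rewrite mxE cplx_sum mulr_suml; apply: eq_bigr => k _.
by rewrite mxE.
Qed.

Lemma trace_mul_tensr m n X (B : 'M[C]_n) :
  \tr (mx_of (m * n) (m * n) X *m (1%:M *t B)) =
  \tr (mx_of n n (ptraceR m n X) *m B).
Proof.
rewrite [LHS]big_mxtens exchange_big; apply: eq_bigr => k _.
under eq_bigr => i _ do rewrite mul_tensr_entry.
rewrite exchange_big [RHS]mxE; apply: eq_bigr => l _.
rewrite mxE cplx_sum mulr_suml; apply: eq_bigr => i _.
by rewrite mxE.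
Qed.

Lemma psdP n A : psd n A <-> psdmx (mx_of n n A).
Proof.
(* The column form [v^* A v] becomes the row form of [psdmx] at the conjugated vector. *)
have formE v : cplx (Csum n (fun i => Csum n (fun j =>
      Cmul (Cconj (v i)) (Cmul (A i j) (v j))))) =
    \tr ((\row_(i < n) (cplx (v i))^*) *m mx_of n n A
         *m (\row_(i < n) (cplx (v i))^*)^t*).
  rewrite /mxtrace big_ord1 mxE cplx_sum.
  under [RHS]eq_bigr => j _ do rewrite mxE mulr_suml.
  rewrite exchange_big; apply: eq_bigr => i _.
  rewrite cplx_sum; apply: eq_bigr => j _.
  by rewrite !mxE conjCK !cplxM cplxJ mulrA.
have ge0E (z : Defs.C) : 0 <= cplx z <-> snd z = 0%R /\ Rle 0 (fst z).
  rewrite lecE /=; split=> [/andP[/eqP -> /RleP] //|[-> /RleP ->]].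
  by rewrite eqxx.
split=> [psdA v|psdA v]; last by apply/ge0E; rewrite formE; apply: psdA.
pose w i := uncplx (if insub i is Some i' then (v 0 i')^* else 0).
have /ge0E := psdA w; rewrite formE.
suff -> : \row_(i < n) (cplx (w i))^* = v by [].
by apply/rowP => i; rewrite mxE /w valK uncplxK conjCK.
Qed.

End Entries.

(** * Matrix exponentials near time zero *)

Section Exponential.
Local Notation C := R[i].
Local Notation "x %:C" := (real_complex R x) : ring_scope.

Lemma parts_le (z : Defs.C) (r : R) : `|cplx z| <= r%:C ->
  Rle (Rabs z.1) r /\ Rle (Rabs z.2) r.
Proof.
move=> zr; split; apply/RleP; rewrite -lecR; apply: le_trans zr.
  exact: (normc_ge_Re (cplx z)).
have := normc_ge_Re (cplx z * 'i%C); rewrite ReiNIm normrN normrM.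
suff -> : `|'i%C| = 1 :> C by rewrite mulr1.
exact: (@normCi C).
Qed.

Lemma norm_le_parts (z : Defs.C) (r : R) : Rle (Rabs z.1) r ->
  Rle (Rabs z.2) r -> `|cplx z| <= (r + r)%:C.
Proof.
move=> /RleP z1 /RleP z2; rewrite rmorphD /= [cplx z]complexE /=.
apply: le_trans (ler_normD _ _) _; apply: lerD.
  by rewrite norm_real_complex lecR.
rewrite normrM [`|'i%C|](_ : _ = 1); last exact: (@normCi C).
by rewrite mul1r norm_real_complex lecR.
Qed.

(** Column sums are the right norm here because [mpow] multiplies by [A] on the right, so each step
    pairs a row of the power with a column of [A]. *)
Lemma mpow_bound n (A : Mat) (r : R) : 0 <= r ->
  (forall j : 'I_n, \sum_(k < n) `|cplx (A k j)| <= r%:C) ->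
  forall m (i j : 'I_n), `|cplx (mpow n A m i j)| <= (r ^+ m)%:C.
Proof.
move=> r0 Ar; elim=> [|m IH] i j.
  have := congr1 (fun M : 'M[C]_n => M i j) (mx_of_id n); rewrite /= !mxE => ->.
  by rewrite normr_nat expr0 rmorph1; case: eqP; rewrite ?ler01.
rewrite /= cplx_sum; apply: le_trans (ler_norm_sum _ _ _) _.
rewrite exprSr rmorphM /=; apply: le_trans (ler_wpM2l _ (Ar j)); last first.
  by rewrite ler0c exprn_ge0.
rewrite mulr_sumr; apply: ler_sum => k _.
by rewrite cplxM normrM ler_wpM2r.
Qed.

(** The existence is informative so that the entries can be assembled into a function of [t]. The
    real and imaginary parts each contribute [exp c] to the remainder. *)
Lemma expm_entry n (H : Mat) (c t : R) (i j : 'I_n) :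
  0 <= c -> (forall j : 'I_n, \sum_(k < n) `|cplx (H k j)| <= c%:C) ->
  {z : Defs.C | `|t| <= 1 ->
    [/\ Un_cv (fun N => fst (expsum n (mscale (0, - t)%R H) N i j)) (fst z),
        Un_cv (fun N => snd (expsum n (mscale (0, - t)%R H) N i j)) (snd z)
      & `|cplx z - ((i == j)%:R + t%:C * (- 'i * cplx (H i j)))|
          <= (exp c + exp c)%:C * (t ^+ 2)%:C]}.
Proof.
(* For [|t| > 1] nothing is claimed, and 0 is a placeholder. *)
move=> c0 Hc; case: (boolP (`|t| <= 1)) => [t1|_]; last by exists Defs.C0.
pose A := mscale (0, - t)%R H.
pose a m := Cmul (/ INR (Factorial.fact m), 0)%R (mpow n A m i j).
have cplx_it : cplx (0, - t)%R = - 'i * t%:C.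
  by apply/eqP; rewrite eq_complex /=; apply/andP; split; apply/eqP; rewrite /=; ring.
have Ar (k : 'I_n) : \sum_(l < n) `|cplx (A l k)| <= (c * `|t|)%:C.
  rewrite (eq_bigr (fun l : 'I_n => `|t|%:C * `|cplx (H l k)|)) => [|l _]; last first.
    by rewrite cplxM cplx_it !normrM normrN normCi mul1r norm_real_complex.
  by rewrite -mulr_sumr mulrC rmorphM ler_wpM2r // ler0c.
have rE m : Rdiv (pow (Rmult c (Rabs t)) m) (INR (Factorial.fact m)) =
    / INR (Factorial.fact m) * (c * `|t|) ^+ m.
  by rewrite -RpowE /Rdiv Rmult_comm.
have a_le m :
    Rle (Rabs (fst (a m))) (Rdiv (pow (Rmult c (Rabs t)) m) (INR (Factorial.fact m))) /\
    Rle (Rabs (snd (a m))) (Rdiv (pow (Rmult c (Rabs t)) m) (INR (Factorial.fact m))).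
  rewrite rE; apply: parts_le; rewrite cplxM normrM.
  have f_gt0 : 0 <= / INR (Factorial.fact m).
    by apply/RleP/Rlt_le/Rinv_0_lt_compat/INR_fact_lt_0.
  rewrite -[cplx (_, _)]/((/ INR (Factorial.fact m))%:C) norm_real_complex.
  rewrite (ger0_norm f_gt0) rmorphM; apply: ler_wpM2l; first by rewrite ler0c.
  by apply: mpow_bound => //; rewrite mulr_ge0.
have t1' : Rle (Rabs t) 1 by apply/RleP.
have c0' : Rle 0 c by apply/RleP.
have [x [x_cv x_le]] := @exp_dominated_series (fun m => fst (a m))
  (fun N => fst (expsum n A N i j)) c t c0' t1' (fun m => (a_le m).1)
  erefl (fun _ => erefl).
have [y [y_cv y_le]] := @exp_dominated_series (fun m => snd (a m))
  (fun N => snd (expsum n A N i j)) c t c0' t1' (fun m => (a_le m).2)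
  erefl (fun _ => erefl).
exists (x, y) => _; split => //.
have -> : cplx (x, y) - ((i == j)%:R + t%:C * (- 'i * cplx (H i j))) =
   cplx (x - (fst (a 0%N) + fst (a 1%N)), y - (snd (a 0%N) + snd (a 1%N)))%R.
  have fact1 : cplx (/ 1, 0)%R = 1 by rewrite Rinv_1.
  have -> : (i == j)%:R = cplx (a 0%N).
    rewrite cplxM [X in _ = X * _]fact1 mul1r.
    by have := congr1 (fun M : 'M[C]_n => M i j) (mx_of_id n); rewrite /= !mxE.
  have -> : t%:C * (- 'i * cplx (H i j)) = cplx (a 1%N).
    rewrite cplxM [X in _ = X * _]fact1 mul1r.
    have : mx_of n n (mmul n mid A) = mx_of n n A.
      by rewrite mx_of_mul mx_of_id mul1mx.
    move/matrixP/(_ i j); rewrite !mxE => ->.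
    by rewrite cplxM cplx_it mulrA [t%:C * _]mulrC.
  by [].
rewrite -rmorphM /= mulrDl; apply: norm_le_parts; rewrite -RpowE //.
Qed.

Lemma expm_jet n (H : Mat) : exists V : R -> Mat,
  (forall t, `|t| <= 1 -> is_expm n (mscale (0, - t)%R H) (V t)) /\
  mjet (fun t => mx_of n n (V t)) 1%:M (- 'i *: mx_of n n H).
Proof.
(* The sum of all absolute entries bounds every column sum, so one constant serves all entries. *)
pose S := \sum_(j < n) \sum_(k < n) `|cplx (H k j)|.
have S0 : 0 <= S by do 2!apply: sumr_ge0 => ? _.
have /complex_realP[c cE] : S \is Num.real by rewrite ger0_real.
have c0 : 0 <= c by rewrite -ler0c -cE.
have Hc (j : 'I_n) : \sum_(k < n) `|cplx (H k j)| <= c%:C.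
  rewrite -cE /S [X in _ <= X](bigD1 j) //= lerDl; do 2!apply: sumr_ge0 => ? _; exact: normr_ge0.
pose z t i j := expm_entry t i j c0 Hc.
pose V t : 'M[C]_n := \matrix_(i, j) cplx (sval (z t i j)).
exists (fun t => of_mx (V t)); split=> [t t1 i j /ssrnat.ltP lt_i /ssrnat.ltP lt_j|i j].
  have := svalP (z t (Ordinal lt_i) (Ordinal lt_j)) t1; case=> x_cv y_cv _.
  have := of_mxK (V t); move/matrixP/(_ (Ordinal lt_i) (Ordinal lt_j)).
  by rewrite !mxE => /(can_inj cplxK) /= ->.
exists (exp c + exp c)%:C => [|t t1].
  by rewrite ler0c addr_ge0 //; apply/RleP/Rlt_le/exp_pos.
by rewrite of_mxK !mxE; case: (svalP (z t i j) t1).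
Qed.

End Exponential.

(** * Kraus form of completely positive maps *)

Section Channels.
Local Notation C := R[i].
Variables (n : nat) (E : Mat -> Mat).

Definition mx_map (X : 'M[C]_n) : 'M[C]_n := mx_of n n (E (of_mx X)).

Hypothesis linE : lin_map n E.

Lemma mx_mapE A : mx_of n n (E A) = mx_map (mx_of n n A).
Proof. by apply/meqP/linE.1/meqP; rewrite of_mxK. Qed.

Lemma mx_map_is_linear : linear mx_map.
Proof.
move=> c X Y.
transitivity (mx_of n n (E (madd (of_mx Y) (mscale (uncplx c) (of_mx X))))).
  by rewrite mx_mapE mx_of_add mx_of_scale !of_mxK uncplxK addrC.
have /meqP -> := linE.2 (uncplx c) (of_mx Y) (of_mx X).
by rewrite mx_of_add mx_of_scale uncplxK addrC.
Qed.

(** Choi's argument: the amplified map applied to the unnormalized maximally entangled projector is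
    positive; factoring it as [B^* B] and reshaping the conjugated rows of [B] gives the Kraus
    operators. *)
Lemma kraus_decomposition : completely_positive n E ->
  exists K : 'I_(n * n) -> 'M[C]_n,
    forall X, mx_map X = \sum_a K a *m X *m (K a)^t*.
Proof.
move=> cpE.
pose diagp p := Nat.eqb (Nat.div p n) (Nat.modulo p n).
(* [diagp] selects the composite indices [a * n + a], so [Omega] is the rank-one matrix of the
   vector [sum_a e_a (x) e_a]. *)
pose Omega : Mat := fun p q => if diagp p && diagp q then Defs.C1 else Defs.C0.
pose u : 'rV[C]_(n * n) := \row_p (diagp p)%:R.
have OmegaE : mx_of (n * n) (n * n) Omega = u^t* *m u.
  apply/matrixP => p q; rewrite !mxE big_ord1 !mxE /Omega conjC_nat.
  by case: (diagp p); case: (diagp q); rewrite /= ?mulr0 ?mul0r ?mulr1.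
have /psdP psd_choi : psd (n * n) (ampl n E Omega).
  apply/cpE/psdP; rewrite OmegaE => v.
  rewrite mulmxA -mulmxA -[u *m _]trmxCK adjM trmxCK trace_sqr.
  by do 2!apply: sumr_ge0 => ? _; rewrite exprn_ge0.
have [B BE] := psdmx_factor psd_choi.
(* Block [(a, b)] of the Choi matrix is the image of the matrix unit [delta_mx a b]. *)
have choiE (a b i j : 'I_n) :
    mx_of (n * n) (n * n) (ampl n E Omega) (mxtens_index (a, i))
      (mxtens_index (b, j)) = mx_map (delta_mx a b) i j.
  rewrite mxE /ampl !Nat_divE !Nat_modE !mxtens_indexK /=.
  rewrite (_ : delta_mx a b = mx_of n n (fun i j => Omega (a * n + i)%N (b * n + j)%N)).
    by rewrite -mx_mapE mxE.
  have diagE (c k : 'I_n) : diagp (c * n + k)%N = (c == k).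
    rewrite /diagp; have [-> ->] := Nat_divmod (ltn_ord k) (erefl (c * n + k)%N).
    by apply/idP/eqP => [/Nat.eqb_spec/val_inj|->]; last exact/Nat.eqb_spec.
  apply/matrixP => k l; rewrite !mxE /Omega !diagE ![_ == k]eq_sym ![_ == l]eq_sym.
  by case: (_ && _).
exists (fun k => \matrix_(i, a) (B k (mxtens_index (a, i)))^*) => X.
have mapX : mx_map X = \sum_a \sum_b X a b *: mx_map (delta_mx a b).
  pose F : {linear 'M[C]_n -> 'M[C]_n} := HB.pack mx_map
    (GRing.isLinear.Build C 'M[C]_n 'M[C]_n _ mx_map mx_map_is_linear).
  rewrite -[mx_map]/(F : _ -> _) {1}[X]matrix_sum_delta linear_sum.
  apply: eq_bigr => a _; rewrite linear_sum; apply: eq_bigr => b _.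
  by rewrite linearZ.
apply/matrixP => i j; rewrite mapX !summxE.
under eq_bigr => a _.
  rewrite summxE; under eq_bigr => b _.
    rewrite mxE -choiE BE mxE mulr_sumr.
    over.
  rewrite exchange_big /=.
  over.
rewrite exchange_big; apply: eq_bigr => k _ /=; rewrite mxE.
under [RHS]eq_bigr => b _ do rewrite mxE mulr_suml.
rewrite [RHS]exchange_big; apply: eq_bigr => a _; apply: eq_bigr => b _ /=.
by rewrite !mxE conjCK mulrA [X a b * _]mulrC.
Qed.

End Channels.

(** The data are carried over to MathComp matrices, where the trace identity [tr (rhoS' [HS, B]) =
    0] for all [B] says that [[HS, rhoS']] is orthogonal to every matrix. *)
Lemma marginal_commutes (dR dS : nat) (HR HS rhoR rhoS : Mat) (E : Mat -> Mat) :
  Defs.hermitian dR HR -> Defs.hermitian dS HS ->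
  density dR rhoR -> density dS rhoS ->
  meq dS (mmul dS rhoS HS) (mmul dS HS rhoS) ->
  channel (dR * dS) E ->
  tt_covariant dR dS HR HS E ->
  meq dR (ptraceS dR dS (E (kron dS rhoR rhoS))) rhoR ->
  let rhoS' := ptraceR dR dS (E (kron dS rhoR rhoS)) in
  meq dS (mmul dS rhoS' HS) (mmul dS HS rhoS').
Proof.
move=> /meqP hHR /meqP hHS [/psdP psd_rhoR _] [/psdP psd_rhoS tr_rhoS].
move=> /meqP comm_rhoS [linE [cpE tpE]] cov /meqP marg rhoS'.
have [K KE] := kraus_decomposition linE cpE.
rewrite mx_of_adj in hHR; rewrite mx_of_adj in hHS.
rewrite !mx_of_mul in comm_rhoS.
pose F : {linear 'M[R[i]]_(dR * dS) -> 'M[R[i]]_(dR * dS)} := HB.pack (mx_map E)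
  (GRing.isLinear.Build _ _ _ _ (mx_map E) (mx_map_is_linear linE)).
have [V [expV jetV]] := expm_jet dR HR.
have [W [expW jetW]] := expm_jet dS HS.
have F_comm := @covariance_deriv _ _ _ _ _ _ _ F hHR hHS jetV jetW.
have mx_of_Ad N U X : mx_of N N (Ad N U X) = mx_of N N U *m mx_of N N X *m (mx_of N N U)^t*.
  by rewrite !mx_of_mul mx_of_adj.
have EF : mx_map E (mx_of dR dR rhoR *t mx_of dS dS rhoS) =
    mx_of _ _ (E (kron dS rhoR rhoS)) by rewrite mx_mapE // mx_of_kron.
have rhoS'_tr B : \tr (mx_of dS dS rhoS' *m comm (mx_of dS dS HS) B) = 0.
  rewrite -trace_mul_tensr -EF.
  apply: (@no_broadcasting_trace _ _ _ _ K (mx_map E) (mx_of dR dR HR)) => //.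
  - by move=> X; rewrite -mx_of_trace tpE mx_of_trace of_mxK.
  - by rewrite -mx_of_trace tr_rhoS.
  - by apply/comm0.
  (* For [|t| <= 1] the curves [V] and [W] are the exponentials, so covariance applies at this
     [t]. *)
  - apply: F_comm => t X t1.
    have /meqP := cov t (V t) (W t) (expV t t1) (expW t t1) (of_mx X).
    by rewrite mx_mapE // !mx_of_Ad !mx_of_kron of_mxK.
  - by move=> A; rewrite EF trace_mul_tensl marg.
apply/meqP; rewrite !mx_of_mul; symmetry; apply/comm0/trace_inj => X.
rewrite mulmx0 mxtrace0 trace_comm; apply/eqP; rewrite oppr_eq0 mxtrace_mulC.
by rewrite rhoS'_tr.
Qed.

End FixedPoints.

Theorem theorem1 (dR dS : nat) (HR HS rhoR rhoS : Mat) (E : Mat -> Mat) :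
  hermitian dR HR -> hermitian dS HS ->
  density dR rhoR -> density dS rhoS ->
  meq dS (mmul dS rhoS HS) (mmul dS HS rhoS) ->
  channel (dR * dS) E ->
  tt_covariant dR dS HR HS E ->
  meq dR (ptraceS dR dS (E (kron dS rhoR rhoS))) rhoR ->
  let rhoS' := ptraceR dR dS (E (kron dS rhoR rhoS)) in
  meq dS (mmul dS rhoS' HS) (mmul dS HS rhoS').
Proof.
exact (@FixedPoints.marginal_commutes dR dS HR HS rhoR rhoS E).
Qed.
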